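(* Let $\mu>0$ and $0<r\le\sqrt{\mu}$ be real numbers. Then the function $$\mathbb{F}_{\mu}(r;z)=z+\sum_{n=2}^{\infty}\frac{n(r^2+1)^{\mu+1}}{(n^2+r^2)^{\mu+1}}z^n,\qquad z\in\mathbb{U},$$ is close-to-convex in $\mathbb{U}$ with respect to the starlike function $g(z)=z/(1-z)$.
   Context: $\mathbb{U}=\{z\in\mathbb{C}:|z|<1\}$ is the open unit disk, and $\mathscr{A}$ is the class of analytic functions $f$ on $\mathbb{U}$ with $f(0)=0$ and $f'(0)=1$. A function $f\in\mathscr{A}$ is called starlike if it maps $\mathbb{U}$ onto a domain that is starlike with respect to the origin; analytically, starlike functions are characterized by $\Re\left(zf'(z)/f(z)\right)>0$ for all $z\in\mathbb{U}$ (the quotient being understood as its limit $1$ at $z=0$). For a starlike function $g$, a function $f\in\mathscr{A}$ is called close-to-convex with respect to $g$ if there is $\theta\in\mathbb{R}$ such that $\Re\left\{e^{i\theta}zf'(z)/g(z)\right\}>0$ for all $z\in\mathbb{U}$ (the quotient at $z=0$ being understood as its limit). *)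

(* Defs.v *)
From Stdlib Require Import Reals.
From Coquelicot Require Import Coquelicot.

Open Scope C_scope.

Definition unit_disk (z : C) : Prop := (Cmod z < 1)%R.

(* [ex_derive] is here complex differentiability (scalar field
   [C_AbsRing]), so this is holomorphy on the disk. *)
Definition analytic_on_disk (f : C -> C) : Prop :=
  forall z : C, unit_disk z -> ex_derive f z.

Definition class_A (f : C -> C) : Prop :=
  analytic_on_disk f /\ f 0 = 0 /\ C_derive f 0 = 1.

Definition image_of_disk (f : C -> C) (w : C) : Prop :=
  exists z : C, unit_disk z /\ f z = w.

(* Connectedness is not listed: it follows from the segment condition. *)
Definition starlike_domain (D : C -> Prop) : Prop :=
  open D /\ D 0 /\
  forall (w : C) (t : R), D w -> (0 <= t <= 1)%R -> D (RtoC t * w).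

Definition univalent (f : C -> C) : Prop :=
  forall z1 z2 : C, unit_disk z1 -> unit_disk z2 -> f z1 = f z2 -> z1 = z2.

(* Univalence is part of the usual notion; without it the geometric condition
   would be weaker than Re (z f'(z) / f(z)) > 0. *)
Definition starlike (f : C -> C) : Prop :=
  class_A f /\ univalent f /\ starlike_domain (image_of_disk f).

(* [l] is the value at [z] of [q], read at the origin as the limit there. *)
Definition value_or_limit_at_0 (q : C -> C) (z l : C) : Prop :=
  (z <> 0 -> l = q z) /\
  (z = 0 -> filterlim q (locally' (0 : C)) (locally l)).

Definition cis (theta : R) : C := (cos theta, sin theta).

Definition close_to_convex_wrt (g f : C -> C) : Prop :=
  starlike g /\ class_A f /\
  exists theta : R, forall z : C, unit_disk z ->
    exists l : C,
      value_or_limit_at_0 (fun w => w * C_derive f w / g w) z l /\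
      (0 < Re (cis theta * l))%R.

(* Sum of a complex series; meaningful only when the series converges. *)
Definition CSeries (a : nat -> C) : C :=
  iota (T := CompleteNormedModule.CompleteSpace _ C_CompleteNormedModule)
    (fun s : C => is_series a s).

Definition F_coef (mu r : R) (n : nat) : R :=
  (INR n * Rpower (r ^ 2 + 1) (mu + 1)
     / Rpower (INR n ^ 2 + r ^ 2) (mu + 1))%R.

(* The k-th term is the one of degree n = k + 2. *)
Definition F_term (mu r : R) (z : C) (k : nat) : C :=
  RtoC (F_coef mu r (k + 2)) * z ^ (k + 2).

Definition F (mu r : R) (z : C) : C := z + CSeries (F_term mu r z).

(* Main.v *)
(** The quotient [z F'(z) / g(z)] is [(1 - z) F'(z)], and the coefficients
    [b_n = n^2 (r^2+1)^(mu+1) / (n^2+r^2)^(mu+1)] of [F'] start at [1], are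
    nonnegative, and decrease for [n >= 1] because [r^2 <= mu].
    Summation by parts then gives [|(1 - z) F'(z) - 1| <= |z| < 1], which yields
    both the positive real part (with [theta = 0]) and the limit at the origin. *)

Require Import Defs.
From Stdlib Require Import Reals Lra Lia.
From Coquelicot Require Import Coquelicot.
Local Open Scope C_scope.


(** * Norm bounds for sums of series *)

(** The norm is continuous, so a uniform bound on partial sums survives the limit. *)
Lemma norm_series_sub_le {K : AbsRing} {V : NormedModule K}
    (a : nat -> V) (s c : V) (k : R) :
  is_series a s ->
  (forall n, norm (minus (sum_n a n) c) <= k)%R ->
  (norm (minus s c) <= k)%R.
Proof.
  intros Ha Hk.
  assert (L : is_lim_seq (fun n => norm (minus (sum_n a n) c))
                (norm (minus s c))).
  { apply (filterlim_comp _ _ _ (fun n => minus (sum_n a n) c) norm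
             eventually (locally (minus s c))); [ | apply filterlim_norm].
    apply (filterlim_comp_2 (G := locally s) (H := locally (opp c))
             _ (fun _ => opp c) plus Ha).
    - apply filterlim_const.
    - apply (filterlim_plus s (opp c)). }
  exact (is_lim_seq_le _ (fun _ => k) _ k Hk L (is_lim_seq_const k)).
Qed.

Lemma norm_series_le {K : AbsRing} {V : NormedModule K}
    (a : nat -> V) (b : nat -> R) (s : V) (t : R) :
  is_series a s -> is_series b t -> (forall n, norm (a n) <= b n)%R ->
  (norm s <= t)%R.
Proof.
  intros Ha Hb Hab.
  assert (L : is_lim_seq (fun n => norm (sum_n a n)) (norm s)).
  { apply (filterlim_comp _ _ _ (sum_n a) norm eventually (locally s));
      [exact Ha | apply filterlim_norm]. }
  apply (is_lim_seq_le (fun n => norm (sum_n a n)) (sum_n b)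
           (norm s) t); [ | exact L | exact Hb].
  intros n. eapply Rle_trans; [apply norm_sum_n_m | ].
  now apply sum_n_m_le.
Qed.

(** * Complex differentiability from quadratic remainders *)

(** A remainder of order [Cmod (y - x) ^ 2] is [o(y - x)]; explicit constants make the criterion
    usable term by term in a series. *)
Lemma is_C_derive_quadratic (f : C -> C) (x l : C) (d k : R) :
  (0 < d)%R -> (0 <= k)%R ->
  (forall y, (Cmod (y - x) < d)%R ->
     (Cmod (f y - f x - (y - x) * l) <= k * Cmod (y - x) ^ 2)%R) ->
  is_derive f x l.
Proof.
  intros Hd Hk H. split.
  - apply (is_linear_scal_l l).
  - intros x' Hx' eps.
    (* Differentiability quantifies over all limit points of the filter [locally x]; the only one is
       [x]. *)
    apply (is_filter_lim_locally_unique (V := AbsRing_NormedModule C_AbsRing)) in Hx'.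
    subst x'.
    (* Dividing by [k + 1] instead of [k] covers [k = 0] and still gives [k * Cmod (y - x) <= eps]
       on this ball. *)
    assert (Hd' : (0 < Rmin d (eps / (k + 1)))%R).
    { apply Rmin_pos; [exact Hd | ].
      apply Rdiv_lt_0_compat; [apply cond_pos | lra]. }
    exists (mkposreal _ Hd'). intros y Hy.
    assert (Hy' : (Cmod (y - x) < Rmin d (eps / (k + 1)))%R) by exact Hy.
    clear Hy.
    assert (H1 := Rlt_le_trans _ _ _ Hy' (Rmin_l _ _)).
    assert (H2 := Rlt_le_trans _ _ _ Hy' (Rmin_r _ _)).
    change (Cmod (f y - f x - (y - x) * l) <= eps * Cmod (y - x))%R.
    eapply Rle_trans; [exact (H y H1) | ].
    assert (H0 := Cmod_ge_0 (y - x)).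
    replace (k * Cmod (y - x) ^ 2)%R with (k * Cmod (y - x) * Cmod (y - x))%R
      by ring.
    apply Rmult_le_compat_r; [exact H0 | ].
    assert (E : ((k + 1) * (eps / (k + 1)) = eps)%R) by (field; lra).
    assert (k * Cmod (y - x) <= k * (eps / (k + 1)))%R
      by (apply Rmult_le_compat_l; lra).
    assert (0 < eps / (k + 1))%R by lra.
    lra.
Qed.

(** The factor is twice the optimal Taylor constant, so that the bounds are the terms of the second
    derivative of the geometric series at [rho]. *)
Lemma pow_second_order (x y : C) (rho : R) (n : nat) :
  (Cmod x <= rho)%R -> (Cmod y <= rho)%R ->
  (Cmod (y ^ S n - x ^ S n - (y - x) * (INR (S n) * x ^ n))
     <= INR n * INR (S n) * rho ^ pred n * Cmod (y - x) ^ 2)%R.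
Proof.
  intros Hx Hy.
  assert (Hr : (0 <= rho)%R) by (eapply Rle_trans; [apply Cmod_ge_0 | exact Hx]).
  induction n as [|n IH].
  - replace (y ^ 1 - x ^ 1 - (y - x) * (INR 1 * x ^ 0)) with (RtoC 0)
      by (simpl; ring).
    rewrite Cmod_0. simpl. lra.
  (* Writing e_n for the remainder, e_(n+1) = y e_n + (n+1) x^n (y-x)^2. *)
  - replace (y ^ S (S n) - x ^ S (S n) - (y - x) * (INR (S (S n)) * x ^ S n))
      with (y * (y ^ S n - x ^ S n - (y - x) * (INR (S n) * x ^ n))
            + INR (S n) * x ^ n * (y - x) ^ 2).
    2: { rewrite (S_INR (S n)), RtoC_plus, !Cpow_S. simpl (Cpow _ 0). ring. }
    eapply Rle_trans; [apply Cmod_triangle | ].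
    rewrite !Cmod_mult, !Cmod_pow, Cmod_R, (Rabs_pos_eq _ (pos_INR _)).
    assert (Hp : (Cmod x ^ n <= rho ^ n)%R)
      by (apply pow_incr; split; [apply Cmod_ge_0 | exact Hx]).
    set (h := (Cmod (y - x) ^ 2)%R) in *.
    assert (Hh : (0 <= h)%R) by (apply pow_le, Cmod_ge_0).
    assert (A1 : (Cmod y * Cmod (y ^ S n - x ^ S n - (y - x) * (INR (S n) * x ^ n))
              <= rho * (INR n * INR (S n) * rho ^ pred n * h))%R)
      by (apply Rmult_le_compat; auto using Cmod_ge_0).
    assert (A2 : (INR (S n) * Cmod x ^ n * h <= INR (S n) * rho ^ n * h)%R).
    { apply Rmult_le_compat_r; [exact Hh | ].
      apply Rmult_le_compat_l; [apply pos_INR | exact Hp]. }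
    assert (A3 : (rho * (INR n * INR (S n) * rho ^ pred n * h)
                  = INR n * INR (S n) * rho ^ n * h)%R).
    (* For [n = 0] the truncated predecessor is harmless: both sides contain the factor [INR 0]. *)
    { destruct n; simpl pred; [simpl; ring | ].
      rewrite <- (tech_pow_Rmult rho n). ring. }
    assert (A4 : (0 <= INR (S n) * rho ^ n * h)%R).
    { apply Rmult_le_pos; [ | exact Hh].
      apply Rmult_le_pos; [apply pos_INR | apply pow_le, Hr]. }
    rewrite A3 in A1. simpl pred.
    rewrite (S_INR (S n)).
    replace (INR (S n) * (INR (S n) + 1) * rho ^ n * h)%R
      with ((INR n + 2) * (INR (S n) * rho ^ n * h))%R
      by (rewrite S_INR; ring).
    replace (INR n * INR (S n) * rho ^ n * h)%R
      with (INR n * (INR (S n) * rho ^ n * h))%R in A1 by ring.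
    lra.
Qed.

(** * Power series with bounded coefficients: convergence and termwise derivative *)

Lemma CSeries_unique (a : nat -> C) (s : C) : is_series a s -> CSeries a = s.
Proof.
  intros H. apply (iota_filterlim_locally (V := C_CompleteNormedModule)). exact H.
Qed.

Lemma CV_radius_const_1 (x : R) :
  (Rabs x < 1)%R -> Rbar_lt (Rabs x) (CV_radius (fun _ => 1%R)).
Proof.
  intros Hx.
  (* The midpoint of [Rabs x] and 1 leaves strict room above [Rabs x]. Were it outside the disk of
     convergence, its powers could not tend to 0. *)
  assert (H : Rbar_le ((Rabs x + 1) / 2)%R (CV_radius (fun _ => 1%R))).
  { rewrite <- (Rabs_pos_eq ((Rabs x + 1) / 2)).
    2: { assert (H := Rabs_pos x). lra. }
    apply Rbar_not_lt_le. intros Hlt.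
    apply (CV_disk_outside _ _ Hlt).
    apply (is_lim_seq_ext (fun n => ((Rabs x + 1) / 2) ^ n)%R).
    - intros n. ring.
    - apply is_lim_seq_geom. rewrite Rabs_pos_eq; assert (H := Rabs_pos x); lra. }
  eapply Rbar_lt_le_trans; [ | exact H]. simpl. lra.
Qed.

Lemma ex_series_deriv_geom (q : R) :
  (0 <= q < 1)%R -> ex_series (fun n => INR (S n) * q ^ n)%R.
Proof.
  intros Hq.
  assert (H : ex_pseries (PS_derive (fun _ => 1%R)) q).
  { apply ex_pseries_derive, CV_radius_const_1. rewrite Rabs_pos_eq; lra. }
  apply ex_pseries_R in H.
  eapply ex_series_ext; [ | exact H].
  intros n. unfold PS_derive. simpl. ring.
Qed.

Lemma ex_series_deriv2_geom (q : R) :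
  (0 <= q < 1)%R -> ex_series (fun n => INR n * INR (S n) * q ^ pred n)%R.
Proof.
  intros Hq.
  assert (H : ex_pseries (PS_derive (PS_derive (fun _ => 1%R))) q).
  { apply ex_pseries_derive. rewrite CV_radius_derive.
    apply CV_radius_const_1. rewrite Rabs_pos_eq; lra. }
  apply ex_pseries_R in H.
  apply ex_series_incr_1.
  eapply ex_series_ext; [ | exact H].
  intros n. unfold PS_derive. simpl pred.
  change (INR (S n) * (INR (S (S n)) * 1) * q ^ n = INR (S n) * INR (S (S n)) * q ^ n)%R.
  ring.
Qed.

Lemma ex_CSeries_bounded (a : nat -> C) (M : R) (z : C) :
  (forall n, Cmod (a n) <= M)%R -> unit_disk z ->
  ex_series (fun n => a n * z ^ n).
Proof.
  intros Ha Hz.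
  apply (ex_series_le (V := C_CompleteNormedModule) _ (fun n => scal M (Cmod z ^ n)%R)).
  - intros n. change (Cmod (a n * z ^ n) <= M * Cmod z ^ n)%R.
    rewrite Cmod_mult, Cmod_pow.
    apply Rmult_le_compat_r; [apply pow_le, Cmod_ge_0 | apply Ha].
  - apply (ex_series_scal (V := R_NormedModule) M), ex_series_geom.
    rewrite Rabs_pos_eq; [exact Hz | apply Cmod_ge_0].
Qed.

Lemma ex_CSeries_deriv_bounded (a : nat -> C) (M : R) (z : C) :
  (forall n, Cmod (a n) <= M)%R -> unit_disk z ->
  ex_series (fun n => INR (S n) * a (S n) * z ^ n).
Proof.
  intros Ha Hz.
  apply (ex_series_le (V := C_CompleteNormedModule) _
           (fun n => scal M (INR (S n) * Cmod z ^ n)%R)).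
  - intros n.
    change (Cmod (INR (S n) * a (S n) * z ^ n) <= M * (INR (S n) * Cmod z ^ n))%R.
    rewrite !Cmod_mult, Cmod_pow, Cmod_R, (Rabs_pos_eq _ (pos_INR _)).
    replace (INR (S n) * Cmod (a (S n)) * Cmod z ^ n)%R
      with (Cmod (a (S n)) * (INR (S n) * Cmod z ^ n))%R by ring.
    apply Rmult_le_compat_r; [ | apply Ha].
    apply Rmult_le_pos; [apply pos_INR | apply pow_le, Cmod_ge_0].
  - apply (ex_series_scal (V := R_NormedModule) M), ex_series_deriv_geom.
    split; [apply Cmod_ge_0 | exact Hz].
Qed.

(** Each monomial has a quadratic remainder by [pow_second_order]; weighted by coefficients of
    modulus at most [M], these sum to at most [M * k * Cmod (y - x) ^ 2], and
    [is_C_derive_quadratic] applies. *)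
Lemma is_derive_CSeries_bounded (f : C -> C) (a : nat -> C) (M : R) (x l : C) :
  (forall n, Cmod (a n) <= M)%R ->
  (forall z, unit_disk z -> is_series (fun n => a n * z ^ n) (f z)) ->
  unit_disk x ->
  is_series (fun n => INR (S n) * a (S n) * x ^ n) l ->
  is_derive f x l.
Proof.
  intros Ha Hf Hx Hl.
  assert (HM : (0 <= M)%R) by (eapply Rle_trans; [apply Cmod_ge_0 | apply (Ha O)]).
  assert (Hx0 := Cmod_ge_0 x). unfold unit_disk in Hx.
  (* Halfway between [Cmod x] and 1: the ball of radius [(1 - Cmod x) / 2] around [x] stays in the
     disk of radius [rho < 1]. *)
  set (rho := ((1 + Cmod x) / 2)%R).
  destruct (ex_series_deriv2_geom rho) as [k Hk]; [unfold rho; lra | ].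
  assert (Hk0 : (0 <= k)%R).
  { apply (Rle_trans _ (norm k)); [apply norm_ge_0 | ].
    apply (norm_series_le _ _ _ _ Hk Hk). intros n.
    apply Req_le, Rabs_pos_eq.
    apply Rmult_le_pos; [apply Rmult_le_pos; apply pos_INR | apply pow_le].
    unfold rho; lra. }
  apply (is_C_derive_quadratic f x l ((1 - Cmod x) / 2) (M * k));
    [lra | now apply Rmult_le_pos | ].
  intros y Hy.
  assert (Hyr : (Cmod y <= rho)%R).
  { replace y with (x + (y - x)) by ring.
    eapply Rle_trans; [apply Cmod_triangle | unfold rho; lra]. }
  assert (Hyd : unit_disk y) by (unfold unit_disk, rho in *; lra).
  set (h2 := (Cmod (y - x) ^ 2)%R).
  assert (Hh2 : (0 <= h2)%R) by (apply pow_le, Cmod_ge_0).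
  (* The constant term is dropped so that the exponent [S n] lines up with the n-th term of the
     derived series. *)
  assert (Shift : forall z, unit_disk z ->
            is_series (fun n => a (S n) * z ^ S n) (f z - a O)).
  { intros z Hz. apply (is_series_incr_1 (fun n => a n * z ^ n)).
    match goal with |- is_series _ ?t => replace t with (f z) end; [now apply Hf | ].
    change (f z = f z - a O + a O * z ^ 0). simpl. ring. }
  assert (Hs := is_series_minus _ _ _ _
                  (is_series_minus _ _ _ _ (Shift y Hyd) (Shift x Hx))
                  (is_series_scal (y - x) _ _ Hl)).
  assert (Hb := is_series_scal (M * h2)%R _ _ Hk).
  assert (Hle := norm_series_le _ _ _ _ Hs Hb).
  change (plus (plus (f y - a O) (opp (f x - a O))) (opp (scal (y - x) l)))
    with ((f y - a O) + - (f x - a O) + - ((y - x) * l)) in Hle.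
  replace ((f y - a O) + - (f x - a O) + - ((y - x) * l))
    with (f y - f x - (y - x) * l) in Hle by ring.
  replace (M * k * h2)%R with (scal (M * h2)%R k)
    by (change (M * h2 * k = M * k * h2)%R; ring).
  apply Hle. intros n.
  change (Cmod (a (S n) * y ^ S n + - (a (S n) * x ^ S n)
                 + - ((y - x) * (INR (S n) * a (S n) * x ^ n)))
          <= M * h2 * (INR n * INR (S n) * rho ^ pred n))%R.
  replace (a (S n) * y ^ S n + - (a (S n) * x ^ S n)
                 + - ((y - x) * (INR (S n) * a (S n) * x ^ n)))
    with (a (S n) * (y ^ S n - x ^ S n - (y - x) * (INR (S n) * x ^ n))) by ring.
  rewrite Cmod_mult.
  replace (M * h2 * (INR n * INR (S n) * rho ^ pred n))%R
    with (M * (INR n * INR (S n) * rho ^ pred n * h2))%R by ring.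
  apply Rmult_le_compat; auto using Cmod_ge_0.
  apply pow_second_order; [unfold rho; lra | exact Hyr].
Qed.

(** * Abel summation, and monotonicity of the quotients behind the coefficients *)

Lemma pow_S_le_self (x : R) (n : nat) : (0 <= x <= 1)%R -> (x ^ S n <= x)%R.
Proof.
  intros Hx. assert (x ^ n <= 1)%R by (rewrite <- (pow1 n); now apply pow_incr).
  assert (x * x ^ n <= x * 1)%R by (apply Rmult_le_compat_l; lra).
  simpl. lra.
Qed.

(* Abel summation: [sum_n u n - d 0 + d n z^(n+1)] is a combination of the
   powers [z^(k+1)] with coefficients [d (k+1) - d k <= 0]. *)
Lemma abel_partial_sum (d : nat -> R) (z : C) (n : nat) :
  (forall n, d (S n) <= d n)%R -> (Cmod z <= 1)%R ->
  (Cmod (sum_n (fun k => (1 - z) * (d k * z ^ k))%C n - d O + d n * z ^ S n)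
     <= Cmod z * (d O - d n))%R.
Proof.
  intros Hd Hz. assert (Hz0 := Cmod_ge_0 z).
  induction n as [|n IH].
  - rewrite sum_O.
    replace ((1 - z) * (d O * z ^ 0) - d O + d O * z ^ 1) with (RtoC 0)
      by (simpl; ring).
    rewrite Cmod_0. lra.
  - rewrite sum_Sn.
    change (plus (sum_n (fun k => (1 - z) * (d k * z ^ k))%C n)
              ((1 - z) * (d (S n) * z ^ S n)))
      with (sum_n (fun k => (1 - z) * (d k * z ^ k))%C n
              + (1 - z) * (d (S n) * z ^ S n)).
    set (s := sum_n _ n) in *.
    replace (s + (1 - z) * (d (S n) * z ^ S n) - d O + d (S n) * z ^ S (S n))
      with ((s - d O + d n * z ^ S n) + (d (S n) - d n)%R * z ^ S n)
      by (rewrite RtoC_minus, !Cpow_S; ring).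
    eapply Rle_trans; [apply Cmod_triangle | ].
    rewrite Cmod_mult, Cmod_pow, Cmod_R.
    specialize (Hd n). rewrite Rabs_left1 by lra.
    assert (Hp := pow_S_le_self (Cmod z) n (conj Hz0 Hz)).
    apply (Rmult_le_compat_l (d n - d (S n))) in Hp; lra.
Qed.

(** Abel summation bounds the main part by |z| (d_0 - d_n), and the boundary term has modulus d_n
    |z|^(n+1), at most |z| d_n. The two add up to |z| d_0 for every n, and the limit keeps the
    bound. *)
Lemma one_sub_mul_monotone_series (d : nat -> R) (z s : C) :
  (forall n, 0 <= d n)%R -> (forall n, d (S n) <= d n)%R -> unit_disk z ->
  is_series (fun n => d n * z ^ n) s ->
  (Cmod ((1 - z) * s - d O) <= Cmod z * d O)%R.
Proof.
  intros H0 Hd Hz Hs. unfold unit_disk in Hz.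
  assert (Hs' := is_series_scal (1 - z) _ _ Hs).
  apply (norm_series_sub_le _ _ (RtoC (d O)) (Cmod z * d O) Hs').
  intros n.
  change (Cmod (sum_n (fun k => (1 - z) * (d k * z ^ k))%C n - d O)
            <= Cmod z * d O)%R.
  set (t := sum_n _ n).
  replace (t - d O) with ((t - d O + d n * z ^ S n) + - (d n * z ^ S n)) by ring.
  eapply Rle_trans; [apply Cmod_triangle | ].
  rewrite Cmod_opp, Cmod_mult, Cmod_pow, Cmod_R, (Rabs_pos_eq _ (H0 n)).
  assert (Ht : (Cmod (t - d O + d n * z ^ S n) <= Cmod z * (d O - d n))%R)
    by (apply abel_partial_sum; [exact Hd | lra]).
  assert (Hz0 := Cmod_ge_0 z).
  assert (Hp := pow_S_le_self (Cmod z) n (conj Hz0 (Rlt_le _ _ Hz))).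
  apply (Rmult_le_compat_l (d n) _ _ (H0 n)) in Hp. lra.
Qed.

(* The logarithmic derivative of [x / (x + q)^(mu + 1)] has the sign of
   [q - mu x]. *)
Lemma ratio_Rpower_decr (mu q s t : R) :
  (0 <= q)%R -> (0 < s)%R -> (s <= t)%R -> (q <= mu * s)%R -> (0 < mu)%R ->
  (t / Rpower (t + q) (mu + 1) <= s / Rpower (s + q) (mu + 1))%R.
Proof.
  intros Hq Hs Hst Hqs Hmu.
  assert (E : forall x, (0 < x)%R ->
            (x / Rpower (x + q) (mu + 1) = exp (ln x - (mu + 1) * ln (x + q)))%R).
  { intros x Hx. unfold Rpower, Rminus.
    rewrite exp_plus, exp_ln, exp_Ropp by exact Hx. reflexivity. }
  rewrite !E by lra.
  destruct (MVT_gen (fun x => ln x - (mu + 1) * ln (x + q))%R s t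
              (fun x => / x - (mu + 1) * / (x + q))%R) as [c [Hc Ec]].
  - rewrite Rmin_left, Rmax_right by exact Hst. intros x Hx.
    auto_derive; [split; [lra | split; [lra | trivial]] | field; lra].
  - rewrite Rmin_left, Rmax_right by exact Hst. intros x Hx.
    apply derivable_continuous_pt, ex_derive_Reals_0.
    auto_derive. split; [lra | split; [lra | trivial]].
  - rewrite Rmin_left, Rmax_right in Hc by exact Hst.
    assert (Hneg : (/ c - (mu + 1) * / (c + q) <= 0)%R).
    { replace (/ c - (mu + 1) * / (c + q))%R
        with (- ((mu * c - q) * / (c * (c + q))))%R by (field; lra).
      assert (mu * s <= mu * c)%R by (apply Rmult_le_compat_l; lra).
      assert (0 < / (c * (c + q)))%R
        by (apply Rinv_0_lt_compat, Rmult_lt_0_compat; lra).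
      assert (0 <= (mu * c - q) * / (c * (c + q)))%R
        by (apply Rmult_le_pos; lra).
      lra. }
    assert (Hle : (ln t - (mu + 1) * ln (t + q)
                   <= ln s - (mu + 1) * ln (s + q))%R).
    { assert ((/ c - (mu + 1) * / (c + q)) * (t - s) <= 0)%R.
      { rewrite <- (Rmult_0_l (t - s)). apply Rmult_le_compat_r; lra. }
      lra. }
    destruct Hle as [Hlt | ->]; [left; now apply exp_increasing | right; reflexivity].
Qed.

(** * The function [F]: coefficients, convergence, derivative and normalization *)

Section Coefficients.

Context (mu r : R) (hmu : (0 < mu)%R) (hr : (0 < r <= sqrt mu)%R).

Lemma F_coef_0 : F_coef mu r 0 = 0%R.
Proof. unfold F_coef. simpl INR. unfold Rdiv. ring. Qed.

Lemma F_coef_1 : F_coef mu r 1 = 1%R.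
Proof.
  unfold F_coef. simpl INR. rewrite pow1, (Rplus_comm 1).
  field. apply Rgt_not_eq, exp_pos.
Qed.

Lemma F_coef_nonneg (n : nat) : (0 <= F_coef mu r n)%R.
Proof.
  unfold F_coef. apply Rdiv_le_0_compat; [ | apply exp_pos].
  apply Rmult_le_pos; [apply pos_INR | left; apply exp_pos].
Qed.

(** This is [ratio_Rpower_decr] at consecutive squares with [q = r ^ 2]. Its condition [q <= mu * s]
    follows from [r <= sqrt mu], as the squares are at least 1. *)
Lemma deriv_coef_decr (n : nat) :
  (INR (S (S n)) * F_coef mu r (S (S n)) <= INR (S n) * F_coef mu r (S n))%R.
Proof.
  assert (E : forall m, (INR m * F_coef mu r m
     = Rpower (r ^ 2 + 1) (mu + 1)
       * (INR m ^ 2 / Rpower (INR m ^ 2 + r ^ 2) (mu + 1)))%R)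
    by (intros m; unfold F_coef, Rdiv; ring).
  rewrite !E. apply Rmult_le_compat_l; [left; apply exp_pos | ].
  assert (Hr2 : (r ^ 2 <= mu)%R).
  { rewrite <- (pow2_sqrt mu) by lra. apply pow_incr. lra. }
  assert (H1 : (1 <= INR (S n))%R) by (rewrite S_INR; assert (H := pos_INR n); lra).
  assert (H2 : (1 <= INR (S n) ^ 2)%R)
    by (rewrite <- (pow1 2); apply pow_incr; lra).
  apply ratio_Rpower_decr; try lra.
  - apply pow2_ge_0.
  - apply pow_incr. rewrite (S_INR (S n)). lra.
  - assert (mu * 1 <= mu * INR (S n) ^ 2)%R by (apply Rmult_le_compat_l; lra).
    lra.
Qed.

Lemma deriv_coef_le_1 (n : nat) : (INR (S n) * F_coef mu r (S n) <= 1)%R.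
Proof.
  induction n as [|n IH].
  - rewrite F_coef_1. simpl. lra.
  - eapply Rle_trans; [apply deriv_coef_decr | exact IH].
Qed.

(** For positive degree the coefficient is at most its product with the degree, hence at most 1.
    This feeds the lemmas on bounded coefficients. *)
Lemma Cmod_F_coef_le_1 (n : nat) : (Cmod (F_coef mu r n) <= 1)%R.
Proof.
  rewrite Cmod_R, Rabs_pos_eq by apply F_coef_nonneg.
  destruct n as [|n]; [rewrite F_coef_0; lra | ].
  eapply Rle_trans; [ | apply (deriv_coef_le_1 n)].
  rewrite <- (Rmult_1_l (F_coef mu r (S n))) at 1.
  apply Rmult_le_compat_r; [apply F_coef_nonneg | ].
  rewrite S_INR. assert (H := pos_INR n). lra.
Qed.

Lemma ex_series_F_coef (z : C) :
  unit_disk z -> ex_series (fun n => F_coef mu r n * z ^ n).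
Proof.
  apply (ex_CSeries_bounded (fun n => RtoC (F_coef mu r n)) 1), Cmod_F_coef_le_1.
Qed.

Lemma ex_series_F_term (z : C) : unit_disk z -> ex_series (F_term mu r z).
Proof.
  intros Hz.
  apply (ex_series_ext (fun n => F_coef mu r (2 + n) * z ^ (2 + n))).
  - intros n. unfold F_term. now rewrite (Nat.add_comm 2 n).
  - apply (ex_series_incr_n (fun n => F_coef mu r n * z ^ n) 2).
    now apply ex_series_F_coef.
Qed.

Lemma is_series_F (z : C) :
  unit_disk z -> is_series (fun n => F_coef mu r n * z ^ n) (F mu r z).
Proof.
  intros Hz. unfold F.
  destruct (ex_series_F_term z Hz : exists s : C, is_series (F_term mu r z) s)
    as [s Hs].
  rewrite (CSeries_unique _ _ Hs).
  (* The coefficients 0 and 1 in degrees 0 and 1 supply the summand [z] of [F], turning it into a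
     full power series. *)
  apply (is_series_decr_n _ 2); [lia | ].
  match goal with |- is_series _ ?t => replace t with s end.
  - apply (is_series_ext (F_term mu r z)); [ | exact Hs].
    intros n. unfold F_term. now rewrite (Nat.add_comm 2 n).
  - simpl pred. rewrite sum_Sn, sum_O, F_coef_0, F_coef_1.
    change (s = z + s + - (0 * z ^ 0 + 1 * z ^ 1)). simpl. ring.
Qed.

(** Termwise differentiation gives [l] as a power series with decreasing nonnegative coefficients
    starting at 1, to which the Abel estimate applies. *)
Lemma F_deriv (z : C) :
  unit_disk z ->
  exists l, is_derive (F mu r) z l /\ (Cmod ((1 - z) * l - 1) <= Cmod z)%R.
Proof.
  intros Hz.
  destruct (ex_CSeries_deriv_bounded _ _ z Cmod_F_coef_le_1 Hz) as [l Hl].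
  exists l. split.
  - exact (is_derive_CSeries_bounded _ _ _ z l Cmod_F_coef_le_1 is_series_F Hz Hl).
  - set (d := fun n => (INR (S n) * F_coef mu r (S n))%R).
    assert (H := one_sub_mul_monotone_series d z l).
    assert (Hd0 : d O = 1%R) by (unfold d; rewrite F_coef_1; simpl; ring).
    rewrite Hd0, Rmult_1_r in H. apply H; [ | apply deriv_coef_decr | exact Hz | ].
    + intros n. apply Rmult_le_pos; [apply pos_INR | apply F_coef_nonneg].
    + eapply is_series_ext; [ | exact Hl].
      intros n. simpl. unfold d. now rewrite RtoC_mult.
Qed.

Lemma F_at_0 : F mu r 0 = 0.
Proof.
  assert (H0 : unit_disk 0) by (unfold unit_disk; rewrite Cmod_0; lra).
  (* The zero series is a majorant at the origin: the constant term vanishes through its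
     coefficient, the others through the power. *)
  assert (H := norm_series_le _ (fun _ => 0%R) _ 0 (is_series_F 0 H0)).
  apply Cmod_eq_0, Rle_antisym; [ | apply Cmod_ge_0].
  apply H.
  - apply (filterlim_ext (fun _ => 0%R)); [ | apply filterlim_const].
    intros n. rewrite sum_n_const. ring.
  - intros [|n].
    + change (Cmod (F_coef mu r 0 * 0 ^ 0) <= 0)%R.
      rewrite F_coef_0, Cmult_0_l, Cmod_0. lra.
    + change (Cmod (F_coef mu r (S n) * 0 ^ S n) <= 0)%R.
      rewrite Cpow_S, Cmult_0_l, Cmult_0_r, Cmod_0. lra.
Qed.

Lemma F_class_A : class_A (F mu r).
Proof.
  split; [ | split].
  - intros z Hz. destruct (F_deriv z Hz) as [l [Hl _]]. now exists l.
  - exact F_at_0.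
  (* At the origin the estimate of [F_deriv] has right-hand side 0, which forces the derivative to
     be 1. *)
  - destruct (F_deriv 0) as [l [Hl Hb]];
      [unfold unit_disk; rewrite Cmod_0; lra | ].
    rewrite (is_C_derive_unique _ _ _ Hl).
    rewrite Cmod_0 in Hb.
    assert (E : (1 - 0) * l - 1 = 0)
      by (apply Cmod_eq_0, Rle_antisym; [exact Hb | apply Cmod_ge_0]).
    replace l with ((1 - 0) * l - 1 + 1) by ring. rewrite E. ring.
Qed.

End Coefficients.

(** * The half-plane map z/(1-z) is starlike *)

Lemma one_sub_neq_0 (z : C) : unit_disk z -> 1 - z <> 0.
Proof.
  intros Hz E. unfold unit_disk in Hz.
  replace z with (1 - (1 - z)) in Hz by ring.
  rewrite E in Hz. replace (1 - 0) with (RtoC 1) in Hz by ring.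
  rewrite Cmod_1 in Hz. lra.
Qed.

(** The first-order remainder is exactly (y-x)^2 / ((1-y)(1-x)^2), hence quadratic. *)
Lemma is_derive_half_plane_map (x : C) :
  unit_disk x -> is_derive (fun z : C => z / (1 - z)) x (/ (1 - x) ^ 2).
Proof.
  intros Hx. assert (Hx1 := one_sub_neq_0 x Hx).
  assert (Hc : (0 < Cmod (1 - x))%R) by (apply Cmod_gt_0; exact Hx1).
  set (c := Cmod (1 - x)) in *.
  (* For |y-x| < c/2 one has |1-y| >= c/2, so the remainder's denominator is at least (c/2) c^2 in
     modulus; this gives 2/c^3. *)
  apply (is_C_derive_quadratic _ x _ (c / 2) (2 / c ^ 3)).
  - lra.
  - left. apply Rdiv_lt_0_compat; [lra | now apply pow_lt].
  - intros y Hy.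
    assert (Hy1 : (c / 2 <= Cmod (1 - y))%R).
    { assert (T : (c <= Cmod (1 - y) + Cmod (y - x))%R).
      { unfold c. replace (1 - x) with ((1 - y) + (y - x)) by ring.
        apply Cmod_triangle. }
      lra. }
    assert (Hyn : 1 - y <> 0) by (apply Cmod_gt_0; lra).
    replace (y / (1 - y) - x / (1 - x) - (y - x) * / (1 - x) ^ 2)
      with ((y - x) ^ 2 * / ((1 - y) * (1 - x) ^ 2)).
    2: { simpl. field. now split. }
    assert (Hd : (1 - y) * (1 - x) ^ 2 <> 0)
      by (apply Cmult_neq_0; [exact Hyn | now apply Cpow_nz]).
    rewrite Cmod_mult, Cmod_pow, (Cmod_inv _ Hd), Cmod_mult, Cmod_pow.
    fold c. rewrite Rmult_comm.
    apply Rmult_le_compat_r; [apply pow_le, Cmod_ge_0 | ].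
    replace (2 / c ^ 3)%R with (/ (c / 2 * c ^ 2))%R by (field; lra).
    assert (Hc2 := pow_lt _ 2 Hc).
    apply Rinv_le_contravar.
    + apply Rmult_lt_0_compat; lra.
    + apply Rmult_le_compat_r; lra.
Qed.

Lemma Cmod_lt_iff_sqr (w v : C) :
  (Cmod w < Cmod v <->
   fst w ^ 2 + snd w ^ 2 < fst v ^ 2 + snd v ^ 2)%R.
Proof.
  unfold Cmod. split.
  - intros H. apply sqrt_lt_0_alt, H.
  - intros H. apply sqrt_lt_1_alt. split; [ | exact H].
    apply Rplus_le_le_0_compat; apply pow2_ge_0.
Qed.

(* [w = z / (1 - z)] means [z = w / (1 + w)], and [|w| < |1 + w|] says that
   [w] is closer to [0] than to [-1]. *)
Lemma image_half_plane_map (w : C) :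
  image_of_disk (fun z => z / (1 - z)) w <-> (- (1 / 2) < Re w)%R.
Proof.
  assert (K : (Cmod w < Cmod (1 + w) <-> - (1 / 2) < Re w)%R).
  { rewrite Cmod_lt_iff_sqr. destruct w as [a b]. unfold Re. simpl. split; nra. }
  rewrite <- K. clear K. split.
  - intros [z [Hz <-]]. assert (Hz1 := one_sub_neq_0 z Hz).
    replace (1 + z / (1 - z)) with (1 / (1 - z)) by (field; exact Hz1).
    unfold Cdiv. rewrite !Cmod_mult, Cmod_1.
    apply Rmult_lt_compat_r; [ | exact Hz].
    apply Cmod_gt_0. intros E. apply C1_nz.
    rewrite <- (Cinv_r _ Hz1), E. ring.
  - intros H.
    assert (Hp : (0 < Cmod (1 + w))%R)
      by (eapply Rle_lt_trans; [apply Cmod_ge_0 | exact H]).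
    assert (Hn : 1 + w <> 0) by (now apply Cmod_gt_0).
    exists (w / (1 + w)). split.
    + unfold unit_disk. rewrite Cmod_div by exact Hn.
      apply (Rmult_lt_reg_r (Cmod (1 + w)) _ _ Hp). unfold Rdiv.
      rewrite Rmult_assoc, Rinv_l by lra. lra.
    + assert (E : 1 - w / (1 + w) = 1 / (1 + w)) by (field; exact Hn).
      rewrite E. field. exact Hn.
Qed.

(** The image is the half-plane Re w > -1/2, which is open, contains 0 and is stable under scaling
    by [t] in [0,1]. *)
Lemma starlike_half_plane_map : starlike (fun z => z / (1 - z)).
Proof.
  assert (H0 : unit_disk 0) by (unfold unit_disk; rewrite Cmod_0; lra).
  split; [split; [ | split] | split].
  - intros z Hz. eexists. now apply is_derive_half_plane_map.
  - unfold Cdiv. ring.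
  - rewrite (is_C_derive_unique _ _ _ (is_derive_half_plane_map 0 H0)).
    simpl. field.
  - intros z1 z2 H1 H2 E.
    apply one_sub_neq_0 in H1. apply one_sub_neq_0 in H2.
    assert (E' : z1 * (1 - z2) = z2 * (1 - z1)).
    { replace (z1 * (1 - z2)) with (z1 / (1 - z1) * ((1 - z1) * (1 - z2)))
        by (field; exact H1).
      rewrite E. field. exact H2. }
    replace z1 with (z1 * (1 - z2) + z1 * z2) by ring.
    rewrite E'. ring.
  - split; [ | split].
    + apply (open_ext (fun w : C => - (1 / 2) < Re w)%R).
      { intros w. symmetry. apply image_half_plane_map. }
      apply (open_comp (T := C_UniformSpace) Re (fun u => - (1 / 2) < u)%R).
      (* Balls of the product uniform structure control the real part separately. *)
      * intros w _ P [eps HP]. exists eps. intros y [Hy _]. now apply HP.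
      * apply open_gt.
    + apply image_half_plane_map. simpl. lra.
    + intros w t Hw Ht. apply image_half_plane_map in Hw. apply image_half_plane_map.
      replace (Re (t * w)) with (t * Re w)%R
        by (destruct w; unfold Re; simpl; ring).
      destruct Ht as [[Ht | <-] Ht1]; nra.
Qed.

(** * Close-to-convexity of [F] *)

Theorem theorem2p1 (mu r : R) (hmu : (0 < mu)%R)
    (hr : (0 < r <= sqrt mu)%R) :
  (forall z : C, unit_disk z -> ex_series (F_term mu r z)) /\
  close_to_convex_wrt (fun z : C => (z / (1 - z))%C) (F mu r).
Proof.
  split; [exact (ex_series_F_term mu r hmu hr) | ].
  split; [exact starlike_half_plane_map | split; [now apply F_class_A | ]].
  set (q := fun w => w * C_derive (F mu r) w / (w / (1 - w))).
  (* Off the origin [q w] simplifies to (1-w) F'(w), so the estimate of [F_deriv] carries over; at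
     the origin its denominator is 0. *)
  assert (Hq : forall w, unit_disk w -> w <> 0 -> (Cmod (q w - 1) <= Cmod w)%R).
  { intros w Hw Hw0. unfold q.
    destruct (F_deriv mu r hmu hr w Hw) as [l [Hl Hb]].
    rewrite (is_C_derive_unique _ _ _ Hl).
    assert (Hw1 := one_sub_neq_0 w Hw).
    replace (w * l / (w / (1 - w))) with ((1 - w) * l); [exact Hb | ].
    field. now split. }
  exists 0%R. intros z Hz.
  assert (Hcis : cis 0 = 1) by (unfold cis; now rewrite cos_0, sin_0).
  rewrite Hcis.
  destruct (Ceq_dec z 0) as [-> | Hz0].
  (* The limit at the origin is 1, since |q(w) - 1| <= |w| there. *)
  - exists 1. split; [split; [easy | intros _] | rewrite Cmult_1_l; simpl; lra].
    apply filterlim_locally. intros eps.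
    assert (L : locally (T := AbsRing_UniformSpace C_AbsRing) (RtoC 0)
                 (fun w : C => w <> 0 ->
                    ball (M := C_UniformSpace) (RtoC 1) eps (q w))).
    { exists (mkposreal (Rmin 1 eps) (Rmin_pos _ _ Rlt_0_1 (cond_pos eps))).
      refine (fun (w : C) Hw (Hw0 : w <> 0) => _).
      assert (Hw' : (Cmod (w - 0) < Rmin 1 eps)%R) by exact Hw.
      replace (w - 0) with w in Hw' by ring.
      apply (C_NormedModule_mixin_compat1 1 (q w) eps).
      eapply Rle_lt_trans; [apply Hq | ].
      - eapply Rlt_le_trans; [exact Hw' | apply Rmin_l].
      - exact Hw0.
      - eapply Rlt_le_trans; [exact Hw' | apply Rmin_r]. }
    (* Passes from neighbourhoods for the modulus to those of the product structure. *)
    apply locally_C in L. exact L.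
  - exists (q z). split; [split; [easy | contradiction] | ].
    rewrite Cmult_1_l.
    (* Re q(z) >= 1 - |q(z) - 1| >= 1 - |z| > 0. *)
    assert (H := Hq z Hz Hz0). unfold unit_disk in Hz.
    assert (H2 := re_le_Cmod (q z - 1)).
    replace (Re (q z - 1)) with (Re (q z) - 1)%R in H2
      by (destruct (q z); unfold Re; simpl; ring).
    apply Rabs_le_between in H2. lra.
Qed.
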